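(* Consider the sparse normal means model: one observes $X=(X_1,\ldots,X_n)$ with $X_i=\theta_i+\varepsilon_i$, $\varepsilon_i$ i.i.d. $\mathcal{N}(0,1)$, with $P_\theta,E_\theta$ the law of $X$ and expectation under $\theta$, and $\ell_0[s_n]=\{\theta\in\mathbb{R}^n:\#\{i:\theta_i\ne0\}\le s_n\}$. Let $\Pi_\alpha=\bigotimes_{i=1}^n((1-\alpha)\delta_0+\alpha G)$ be the spike and slab prior with slab $G$ the Laplace distribution $\mathrm{Lap}(1)$ (density $\gamma(x)=\frac12e^{-|x|}$), and let $\Pi_{\hat\alpha}[\cdot\mid X]$ be the plug-in posterior, where $\hat\alpha$ maximises over $[\alpha_n,1]$ the log-marginal likelihood $\ell_n(\alpha)=\sum_{i=1}^n\log((1-\alpha)\phi(X_i)+\alpha g(X_i))$, with $\phi$ the standard normal density, $g=\phi*\gamma$, and $\alpha_n$ defined by $t(\alpha_n)=\sqrt{2\log n}$. Then there exists $m>0$ such that for any sequence $s_n$ with $s_n/n\to0$ and $\log^2 n=O(s_n)$ as $n\to\infty$, there exists $\theta_0\in\ell_0[s_n]$ (for each $n$) such that, as $n\to\infty$, \[ E_{\theta_0}\,\Pi_{\hat\alpha}\Big[\|\theta-\theta_0\|^2\le m\,s_n\,e^{\sqrt{2\log(n/s_n)}}\ \Big|\ X\Big]=o(1), \] with $\|\cdot\|$ the Euclidean norm.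
   Context: For fixed $\alpha$, the posterior is $\Pi_\alpha[\cdot\mid X]=\bigotimes_{i=1}^n((1-a(X_i))\delta_0+a(X_i)G_{X_i})$ with $a(x)=\frac{\alpha g(x)}{(1-\alpha)\phi(x)+\alpha g(x)}$ and $G_x$ of density $\gamma_x(u)=\phi(x-u)\gamma(u)/g(x)$; $\Pi_{\hat\alpha}[\cdot\mid X]$ is this with $\alpha=\hat\alpha$. The threshold $t(\alpha)>0$ is the posterior median threshold for fixed $\alpha$: the coordinatewise posterior median of $\theta_i$ is $0$ iff $|X_i|\le t(\alpha)$; $t(\cdot)$ is continuous and strictly decreasing. *)

(* Defs.v *)
From HB Require Import structures.
From mathcomp Require Import all_boot all_order all_algebra.
From mathcomp Require Import all_classical all_reals all_analysis.
Set Implicit Arguments. Unset Strict Implicit. Unset Printing Implicit Defensive.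
Import Order.TTheory GRing.Theory Num.Theory.
Import numFieldNormedType.Exports.
Local Open Scope classical_set_scope.
Local Open Scope ring_scope.

Section SpikeSlab.
Variable R : realType.

(** Integration against a product of n one-dimensional "integration
    operators" (one per coordinate) over the vectors of R^n, represented as
    n.-tuple R.  If [I i h = \int[mu_i]_x h x] for measures mu_i, then
    [iter_int n I F] is the iterated integral of F against mu_0,...,mu_(n-1),
    i.e. (Tonelli) the integral of F against the product measure
    mu_0 \x ... \x mu_(n-1) for nonnegative measurable F. *)
Fixpoint iter_int (n : nat) (I : nat -> (R -> \bar R) -> \bar R)
  : (n.-tuple R -> \bar R) -> \bar R :=
  match n return (n.-tuple R -> \bar R) -> \bar R with
  | 0 => fun F => F [tuple]
  | n'.+1 => fun F =>
      I 0%N (fun x => iter_int (fun i => I i.+1) (fun t => F (cons_tuple x t)))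
  end.

Definition phi (x : R) : R := normal_pdf 0 1 x.

Definition lap (x : R) : R := expR (- `|x|) / 2.

Definition gconv (x : R) : R :=
  fine (\int[lebesgue_measure]_u ((phi (x - u) * lap u)%:E))%E.

Definition post_a (alpha x : R) : R :=
  alpha * gconv x / ((1 - alpha) * phi x + alpha * gconv x).

Definition gam_x (x u : R) : R := phi (x - u) * lap u / gconv x.

Definition post_int (alpha x : R) (h : R -> \bar R) : \bar R :=
  ((1 - post_a alpha x)%:E * h 0%R +
   (post_a alpha x)%:E * \int[lebesgue_measure]_u (h u * (gam_x x u)%:E))%E.

Definition post_prob (n : nat) (alpha : R) (x : n.-tuple R)
  (B : set (n.-tuple R)) : \bar R :=
  iter_int (fun i => post_int alpha (nth 0 x i)) (fun th => (\1_B th)%:E).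

Definition expect (n : nat) (theta0 : n.-tuple R) (F : n.-tuple R -> \bar R)
  : \bar R :=
  iter_int (fun i h => \int[normal_prob (nth 0%R theta0 i) 1]_y h y)%E F.

Definition loglik (n : nat) (x : n.-tuple R) (alpha : R) : R :=
  \sum_(i < n) ln ((1 - alpha) * phi (tnth x i) + alpha * gconv (tnth x i)).

Definition median_is_zero (alpha x : R) : Prop :=
  (post_int alpha x (fun u => (\1_(`]-oo, 0]) u)%:E) >= (2^-1)%:E)%E /\
  (post_int alpha x (fun u => (\1_(`[0, +oo[) u)%:E) >= (2^-1)%:E)%E.

(** posterior median threshold t(alpha): the median is 0 iff |x| <= t(alpha) *)
Definition thresh (alpha : R) : R :=
  sup [set x : R | 0 <= x /\ median_is_zero alpha x].

Definition sqdist (n : nat) (u v : n.-tuple R) : R :=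
  \sum_(i < n) (tnth u i - tnth v i) ^+ 2.

Definition ell0 (n s : nat) (th : n.-tuple R) : Prop :=
  (#|[set i : 'I_n | tnth th i != 0%R]| <= s)%N.

End SpikeSlab.

(* Main.v *)
Require Import Defs.
From HB Require Import structures.
From mathcomp Require Import all_boot all_order all_algebra.
From mathcomp Require Import all_classical all_reals all_analysis.
From mathcomp Require Import measurable_realfun.
From mathcomp Require Import ring lra.
Import Order.TTheory GRing.Theory Num.Theory.
Import numFieldNormedType.Exports.
Local Open Scope classical_set_scope.
Local Open Scope ring_scope.

(* Write r = s/n, L = sqrt(2 log(n/s)), so r = exp(-L^2/2), and a = c e^L r for a
   small constant c.  Take theta_0 with s equal, huge nonzero coordinates.

   alpha_hat >= a with high probability: with w = phi/((1-a)phi + a g), concavity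
   of the log-likelihood shows that alpha_hat < a forces sum_i (1 - w(X_i)) <= 0,
   hence 1 <= prod_i exp(w(X_i) - 1).  Under N(0,1) a factor has mean at most
   1 + C c r, because the tails of g beyond L have mass of order e^{-L}; under a
   huge mean it is at most e^{-1/2}.  The product has mean at most e^{-s/4}.

   If alpha_hat >= a, each null coordinate with X_i in [0,1] has posterior mass of
   order a away from zero, so of order n a = c s e^L of the theta_i are.  The bound
   1{||theta - theta_0||^2 <= M} <= e^M prod_i exp(-(theta_i - theta_{0,i})^2)
   again leaves a product, whose mean is exponentially small when M = m s e^L.

   Both bounds are pointwise in X, so only iterated integrals of products occur. *)

(** * Comparison of integrals, one-dimensional and iterated *)

(** The integral of a nonnegative function is a supremum over simple functions below it, which is
    monotone for arbitrary functions. Inner iterated integrals can thus be bounded as they stand. *)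
Lemma ge0_le_integral_nomeas d (T : measurableType d) (R : realType)
    (mu : {measure set T -> \bar R}) (f g : T -> \bar R) :
  (forall x, 0 <= f x <= g x)%E -> (\int[mu]_x f x <= \int[mu]_x g x)%E.
Proof.
move=> fg.
have f0 x : (0 <= f x)%E by have /andP[] := fg x.
have g0 x : (0 <= g x)%E by have /andP[/le_trans +] := fg x; apply.
rewrite !ge0_integralTE//; apply: le_ereal_sup => _ /= [h hf <-].
by exists h => // x; apply: le_trans (hf x) _; have /andP[] := fg x.
Qed.

(** A change of variables produces the Radon-Nikodym derivative of the normal law; it has the same
    integral as [normal_pdf] over every measurable set, hence agrees with it almost everywhere. *)
Lemma integral_normal_prob (R : realType) (m : R) (f : R -> R) :
  measurable_fun setT f -> (forall x, 0 <= f x) ->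
  (\int[normal_prob m 1]_x (f x)%:E =
   \int[lebesgue_measure]_x (f x * normal_pdf m 1 x)%:E)%E.
Proof.
move=> mf f0; have dom := @normal_prob_dominates R m 1.
have mf' : measurable_fun setT (fun x => (f x)%:E) by exact/measurable_EFinP.
have mn : measurable_fun setT (fun x => (normal_pdf m 1 x)%:E).
  by apply: measurableT_comp => //; exact: measurable_normal_pdf.
rewrite -(Radon_Nikodym_SigmaFinite.change_of_variables dom)//=.
under [RHS]eq_integral do rewrite EFinM.
have iRN := Radon_Nikodym_SigmaFinite.f_integrable dom.
apply: ae_eq_integral => //=.
- by apply: emeasurable_funM => //; apply: (measurable_int _ iRN).
- exact: emeasurable_funM.
- apply: ae_eqe_mul2l => /=; apply: integral_ae_eq => //=.
  by move=> E _ mE; rewrite -Radon_Nikodym_SigmaFinite.f_integral.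
Qed.

(* The two-term bound accommodates a case split on the data without any
   measurability of the integrand F. *)
Lemma iter_int_le (R : realType) n (I : nat -> (R -> \bar R) -> \bar R)
    (psi chi : nat -> R -> R) (p q : nat -> R) (A B : R) (F : n.-tuple R -> \bar R) :
  (forall i x, 0 <= psi i x) -> (forall i x, 0 <= chi i x) ->
  (forall i, (i < n)%N -> forall a b (h : R -> \bar R), 0 <= a -> 0 <= b ->
    (forall x, 0 <= h x <= (a * psi i x + b * chi i x)%:E)%E ->
    (0 <= I i h <= (a * p i + b * q i)%:E)%E) ->
  0 <= A -> 0 <= B ->
  (forall t, 0 <= F t <= (A * \prod_(i < n) psi i (tnth t i) +
                         B * \prod_(i < n) chi i (tnth t i))%:E)%E ->
  (0 <= iter_int I F <= (A * \prod_(i < n) p i + B * \prod_(i < n) q i)%:E)%E.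
Proof.
elim: n I psi chi p q A B F => [|n IH] I psi chi p q A B F psi0 chi0 HI A0 B0 HF /=.
  by have := HF [tuple]; rewrite !big_ord0.
rewrite !big_ord_recl /= !mulrA.
(* With the first coordinate fixed at [x], the induction hypothesis is applied with [A] and [B]
   multiplied by [psi 0 x] and [chi 0 x]. *)
suff H x : (0 <= iter_int (fun i => I i.+1) (fun t => F (cons_tuple x t)) <=
   ((A * \prod_(i < n) p i.+1) * psi 0%N x + (B * \prod_(i < n) q i.+1) * chi 0%N x)%:E)%E.
  (* Nonnegativity of [p i] and [q i] comes from [HI] at the zero function. *)
  have pq i : (i < n.+1)%N -> 0 <= p i /\ 0 <= q i.
    move=> ni; split.
      have /andP[+ h2] : (0 <= I i (cst 0) <= (1 * p i + 0 * q i)%:E)%E.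
        by apply: HI => // x; rewrite lexx lee_fin mul1r mul0r addr0 psi0.
      by move=> /le_trans/(_ h2); rewrite lee_fin mul1r mul0r addr0.
    have /andP[+ h2] : (0 <= I i (cst 0) <= (0 * p i + 1 * q i)%:E)%E.
      by apply: HI => // x; rewrite lexx lee_fin mul1r mul0r add0r chi0.
    by move=> /le_trans/(_ h2); rewrite lee_fin mul1r mul0r add0r.
  rewrite [A * _ * _]mulrAC [B * _ * _]mulrAC; apply: HI => //; rewrite mulr_ge0// prodr_ge0// => i _.
    by have [] := pq i.+1 (ltn_ord i).
  by have [] := pq i.+1 (ltn_ord i).
rewrite [A * _ * _]mulrAC [B * _ * _]mulrAC.
apply: (IH _ (fun i => psi i.+1) (fun i => chi i.+1) (fun i => p i.+1) (fun i => q i.+1)) => //.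
- by move=> i ni; apply: HI.
- by rewrite mulr_ge0.
- by rewrite mulr_ge0.
move=> t; have := HF (cons_tuple x t).
rewrite !big_ord_recl !mulrA /=.
have E i : tnth (cons_tuple x t) (lift ord0 i) = tnth t i by rewrite !(tnth_nth 0).
by under eq_bigr do rewrite E; under [X in (_ + _ * X)%:E]eq_bigr do rewrite E.
Qed.

(** * The normal and Laplace densities and their convolution g *)

Section densities.
Variable R : realType.
Implicit Types x u a : R.
Local Notation mu := (@lebesgue_measure R).
Local Notation phi0 := (@normal_peak R 1).

Lemma phi0_gt0 : 0 < phi0.
Proof. exact: normal_peak_gt0. Qed.

Lemma normal_pdf_phi a x : normal_pdf a 1 x = phi (x - a).
Proof.
by rewrite /phi !normal_pdfE ?oner_neq0// /normal_fun subr0.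
Qed.

Lemma phiE x : phi x = phi0 * expR (- (x ^+ 2 / 2)).
Proof.
by rewrite /phi normal_pdfE ?oner_neq0// /normal_fun subr0 expr1n mulNr.
Qed.

Lemma phiN x : phi (- x) = phi x.
Proof. by rewrite !phiE sqrrN. Qed.

Lemma phi_gt0 x : 0 < phi x.
Proof. by rewrite phiE mulr_gt0 ?expR_gt0 ?phi0_gt0. Qed.

Lemma phi_ge x a : `|x| <= a -> phi a <= phi x.
Proof.
move=> xa; rewrite !phiE ler_pM2l ?phi0_gt0// ler_expR lerN2 ler_pM2r//.
rewrite -[leLHS]real_normK ?num_real// lerXn2r ?nnegrE//.
exact: le_trans xa.
Qed.

Lemma phi_le x : phi x <= phi0.
Proof. by rewrite phiE ler_piMr ?(ltW phi0_gt0)// expR_le1 oppr_le0 divr_ge0 ?sqr_ge0. Qed.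

Lemma phi_expR_norm x : phi x * expR `|x| <= phi0 * expR 2 * expR (- `|x|).
Proof.
rewrite phiE -2!mulrA ler_pM2l ?phi0_gt0// -!expRD ler_expR.
rewrite -[x ^+ 2]real_normK ?num_real//.
have := sqr_ge0 (`|x| - 2); lra.
Qed.

Lemma measurable_phi a : measurable_fun [set: R] (fun x => phi (x - a)).
Proof.
under eq_fun do rewrite -normal_pdf_phi.
exact: measurable_normal_pdf.
Qed.

Lemma integral_phi a : (\int[mu]_x (phi (x - a))%:E = 1)%E.
Proof.
under eq_integral do rewrite -normal_pdf_phi.
exact: integral_normal_pdf.
Qed.

Lemma lap_gt0 x : 0 < lap x.
Proof. by rewrite divr_gt0 ?expR_gt0. Qed.

Lemma continuous_lap : continuous (@lap R).
Proof.
move=> x; apply: cvgM; last exact: cvg_cst.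
apply: continuous_comp; last exact: continuous_expR.
by apply: cvgN; exact: norm_continuous.
Qed.

Lemma measurable_lap : measurable_fun [set: R] (@lap R).
Proof. exact: continuous_measurable_fun continuous_lap. Qed.

(** By symmetry this is twice the integral over the half-line, where [2 * lap] is the exponential
    density of rate 1. *)
Lemma integral_lap : (\int[mu]_x (lap x)%:E = 1)%E.
Proof.
rewrite ge0_symfun_integralT; [|by move=> x; exact/ltW/lap_gt0|exact: continuous_lap|].
  rewrite -(integral_exponential_pdf (ltr01 : 0 < 1 :> R)).
  rewrite integral_mkcond -ge0_integralZl//=.
  - apply: eq_integral => x _; rewrite patchE; case: ifPn => [|/negP]; rewrite inE /= => x0.
      rewrite exponential_pdfE// /lap ger0_norm// -EFinM; congr (_%:E).
      by rewrite mulN1r mul1r mulrCA divff ?mulr1.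
    by rewrite /point /= mule0 lt0_exponential_pdf// ltNge; apply/negP.
  - apply/(measurable_restrictT _ _).1; first by rewrite -set_itvcy.
    by apply: measurable_funTS; apply: measurableT_comp => //; exact: measurable_lap.
  - by move=> x _; rewrite patchE; case: ifP => // _; rewrite lee_fin ltW// lap_gt0.
by move=> x; rewrite /lap /= normrN.
Qed.

Lemma measurable_phi_lap x : measurable_fun [set: R] (fun u => phi (x - u) * lap u).
Proof.
apply: measurable_funM; last exact: measurable_lap.
by under eq_fun do rewrite -opprB phiN; exact: measurable_phi.
Qed.

Lemma phi_lap_ge0 x u : 0 <= phi (x - u) * lap u.
Proof. by rewrite mulr_ge0// ltW ?phi_gt0 ?lap_gt0. Qed.

(* Rests on e^|z| <= e^z + e^-z and e^z phi(z) = e^(1/2) phi(z - 1), with z = x - u. *)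
Lemma phi_lap_le x u : phi (x - u) * lap u <=
  expR (2^-1) / 2 * expR (- `|x|) * (phi (u - (x - 1)) + phi (u - (x + 1))).
Proof.
have -> : expR (2^-1) / 2 * expR (- `|x|) * (phi (u - (x - 1)) + phi (u - (x + 1))) =
  expR (- `|x|) / 2 * (expR 2^-1 * phi (u - (x - 1)) + expR 2^-1 * phi (u - (x + 1))) by ring.
have E1 : expR 2^-1 * phi (u - (x - 1)) = phi (x - u) * expR (x - u).
  by rewrite !phiE mulrCA -!mulrA -!expRD; congr (_ * expR _); field.
have E2 : expR 2^-1 * phi (u - (x + 1)) = phi (x - u) * expR (- (x - u)).
  by rewrite !phiE mulrCA -!mulrA -!expRD; congr (_ * expR _); field.
rewrite E1 E2 -mulrDr /lap [leRHS]mulrCA ler_pM2l ?phi_gt0// mulrAC ler_pM2r//.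
apply: (@le_trans _ _ (expR (- `|x|) * expR `|x - u|)).
  by rewrite -expRD ler_expR; have := lerB_dist x u; lra.
rewrite ler_pM2l ?expR_gt0//; case: (ger0P (x - u)) => _.
  by rewrite lerDl expR_ge0.
by rewrite lerDr expR_ge0.
Qed.

(** Integrates the preceding bound, in which the two shifted normal densities have total mass 2. *)
Lemma integral_phi_lap_le x :
  (\int[mu]_u (phi (x - u) * lap u)%:E <= (expR (2^-1) * expR (- `|x|))%:E)%E.
Proof.
apply: (@le_trans _ _ (\int[mu]_u ((expR (2^-1) / 2 * expR (- `|x|))%:E *
  ((phi (u - (x - 1)))%:E + (phi (u - (x + 1)))%:E)))%E).
  apply: ge0_le_integral_nomeas => u.
  by rewrite lee_fin phi_lap_ge0 -EFinD -EFinM lee_fin phi_lap_le.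
have m a : measurable_fun [set: R] (fun u => (phi (u - a))%:E).
  by apply: measurableT_comp => //; exact: measurable_phi.
have p0 a u : (0 <= (phi (u - a))%:E)%E by rewrite lee_fin ltW ?phi_gt0.
rewrite ge0_integralZl//; [|by apply: emeasurable_funD; exact: m|by move=> u _; rewrite adde_ge0].
rewrite ge0_integralD//; [|exact: m|exact: m].
by rewrite !integral_phi -EFinD -EFinM lee_fin; lra.
Qed.

(** [fine] in the definition of [gconv] would send an infinite integral to 0; the bound just
    obtained rules this out. *)
Lemma gconvE x : (gconv x)%:E = (\int[mu]_u (phi (x - u) * lap u)%:E)%E.
Proof.
rewrite fineK// fin_num_abs gee0_abs; last first.
  by apply: integral_ge0 => u _; rewrite lee_fin phi_lap_ge0.
exact: le_lt_trans (integral_phi_lap_le x) (ltry _).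
Qed.

Lemma gconv_le x : gconv x <= expR (2^-1) * expR (- `|x|).
Proof. by rewrite -lee_fin gconvE integral_phi_lap_le. Qed.

Lemma integral_ge_itv (f : R -> R) a c : 0 <= c -> (forall u, 0 <= f u) ->
  (forall u, a <= u <= a + 1 -> c <= f u) -> (c%:E <= \int[mu]_u (f u)%:E)%E.
Proof.
move=> c0 f0 cf.
apply: (@le_trans _ _ (\int[mu]_u (c%:E * (\1_(`[a, a + 1]) u)%:E))%E); last first.
  apply: ge0_le_integral_nomeas => u; rewrite -EFinM !lee_fin mulr_ge0//= indicE.
  have [|_] := boolP (u \in _); last by rewrite mulr0.
  by rewrite inE /= in_itv/= mulr1 => /cf.
rewrite ge0_integralZl//=.
- rewrite integral_indic//= setIT lebesgue_measure_itv/= lte_fin ltrDl ltr01.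
  by rewrite -EFinD addrAC subrr add0r mule1.
- exact: measurableT_comp.
Qed.

(** For u in [x, x + 1] the normal factor is at least [phi 1] and the Laplace factor loses at most
    [expR (-1)]. Together with [gconv_le], g has exact order e^{-|x|}. *)
Lemma gconv_ge x : phi 1 * expR (-1) / 2 * expR (- `|x|) <= gconv x.
Proof.
rewrite -lee_fin gconvE; apply: (@integral_ge_itv _ x).
- by rewrite !mulr_ge0 ?expR_ge0// ltW ?phi_gt0.
- by move=> u; exact: phi_lap_ge0.
move=> u /andP[xu ux]; rewrite /lap -!mulrA; apply: ler_pM.
- by rewrite ltW ?phi_gt0.
- by rewrite !mulr_ge0 ?expR_ge0.
- by apply: phi_ge; rewrite ler_norml; apply/andP; split; lra.
rewrite mulrCA mulrC ler_pM2r// -expRD ler_expR.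
have := ler_normD x (u - x); rewrite addrCA subrr addr0.
by rewrite [`|u - x|]ger0_norm; lra.
Qed.

Lemma gconv_gt0 x : 0 < gconv x.
Proof.
apply: lt_le_trans (gconv_ge x).
by rewrite !mulr_gt0 ?expR_gt0// phi_gt0.
Qed.

Let mK a : measurable_fun [set: R * R] (fun z => (phi (z.1 - a - z.2) * lap z.2)%:E).
Proof.
apply: measurableT_comp => //; apply: measurable_funM.
  have /= H := measurable_phi 0.
  under eq_fun do rewrite -[_ - _ - _]subr0.
  apply: (measurableT_comp H) => /=.
  by apply: measurable_funB => //; apply: measurable_funB.
by apply: measurableT_comp => //; exact: measurable_lap.
Qed.

Lemma measurable_gconv a : measurable_fun [set: R] (fun x => gconv (x - a)).
Proof.
have H : measurable_fun [set: R] (fun x => (\int[mu]_u (phi (x - a - u) * lap u)%:E)%E).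
  apply: (measurable_fun_fubini_tonelli_F (m2 := mu) _ (mK a)) => z.
  by rewrite lee_fin phi_lap_ge0.
exact: (measurableT_comp (fine_measurable measurableT) H).
Qed.

(** By Tonelli: for fixed u the inner integral is the mass of a shifted normal density, which leaves
    the mass of the Laplace density. *)
Lemma integral_gconv a : (\int[mu]_x (gconv (x - a))%:E = 1)%E.
Proof.
under eq_integral do rewrite gconvE.
rewrite (fubini_tonelli (m1 := mu) (m2 := mu)
  (fun z : R * R => (phi (z.1 - a - z.2) * lap z.2)%:E) (mK a)) /=; last first.
  by move=> z; rewrite lee_fin phi_lap_ge0.
rewrite -integral_lap; apply: eq_integral => u _.
under eq_integral do rewrite mulrC EFinM -addrA -opprD.
rewrite ge0_integralZl ?integral_phi ?mule1//.
- by apply: measurableT_comp => //; exact: measurable_phi.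
- by move=> x _; rewrite lee_fin ltW ?phi_gt0.
- by rewrite lee_fin ltW ?lap_gt0.
Qed.

End densities.

(** * Sums and differences of integrals of real functions *)

Section integrals.
Variable R : realType.
Local Notation mu := (@lebesgue_measure R).
Implicit Types f g k h : R -> R.

Lemma integral_lincomb f g (a b u v : R) : 0 <= a -> 0 <= b ->
  measurable_fun [set: R] f -> measurable_fun [set: R] g ->
  (forall x, 0 <= f x) -> (forall x, 0 <= g x) ->
  (\int[mu]_x (f x)%:E = u%:E)%E -> (\int[mu]_x (g x)%:E = v%:E)%E ->
  (\int[mu]_x (a * f x + b * g x)%:E = (a * u + b * v)%:E)%E.
Proof.
move=> a0 b0 mf mg f0 g0 fu gv.
have mE h c : measurable_fun [set: R] h -> measurable_fun [set: R] (fun x => (c%:E * (h x)%:E)%E).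
  move=> mh; apply: emeasurable_funM => //; exact: measurableT_comp.
under eq_integral do rewrite EFinD !EFinM.
rewrite ge0_integralD//; [|by move=> x _; rewrite -EFinM lee_fin mulr_ge0|exact: mE
  |by move=> x _; rewrite -EFinM lee_fin mulr_ge0|exact: mE].
have mF h : measurable_fun [set: R] h -> measurable_fun [set: R] (fun x => (h x)%:E).
  by move=> mh; exact: measurableT_comp.
rewrite ge0_integralZl//; [|exact: mF|by move=> x _; rewrite lee_fin].
rewrite ge0_integralZl//; [|exact: mF|by move=> x _; rewrite lee_fin].
by rewrite fu gv.
Qed.

(** The form f + k <= h keeps every integrand nonnegative; the subtraction is carried out on finite
    numbers only. *)
Lemma integral_le_sub f k h (c M : R) :
  measurable_fun [set: R] f -> measurable_fun [set: R] k ->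
  (forall x, 0 <= f x) -> (forall x, 0 <= k x) ->
  (forall x, f x + k x <= h x) ->
  (c%:E <= \int[mu]_x (k x)%:E)%E -> (\int[mu]_x (h x)%:E <= M%:E)%E ->
  (\int[mu]_x (f x)%:E <= (M - c)%:E)%E.
Proof.
move=> mf mk f0 k0 fkh ck hM.
have H : (\int[mu]_x (f x)%:E + \int[mu]_x (k x)%:E <= M%:E)%E.
  rewrite -ge0_integralD//; [|by move=> x _; rewrite lee_fin|exact: measurableT_comp
    |by move=> x _; rewrite lee_fin|exact: measurableT_comp].
  apply: le_trans hM; apply: ge0_le_integral_nomeas => x.
  by rewrite -EFinD !lee_fin fkh addr_ge0.
rewrite EFinB leeBrDr//; apply: le_trans H.
by rewrite leeD2l.
Qed.

Lemma le_integral_EFin f h : (forall x, 0 <= f x <= h x) ->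
  (\int[mu]_x (f x)%:E <= \int[mu]_x (h x)%:E)%E.
Proof. by move=> fh; apply: ge0_le_integral_nomeas => x; rewrite !lee_fin. Qed.

End integrals.

(** * Elementary upper bounds for the exponential *)

Section exp_bounds.
Variable R : realType.
Implicit Types x y : R.

Lemma expR_le_inv y : y < 1 -> expR y <= (1 - y)^-1.
Proof.
move=> y1; rewrite -[y in expR y]opprK expRN lef_pV2 ?posrE ?expR_gt0 ?subr_gt0//.
exact: expR_ge1Dx.
Qed.

Lemma expR_le_quad y : -1 <= y <= 1 -> expR y <= 1 + y + 2 * y ^+ 2.
Proof.
move=> /andP[y1 y2]; have [y0|y0] := leP y 0.
  apply: (le_trans (expR_le_inv y _)); first lra.
  rewrite -[leLHS]mul1r ler_pdivrMr; last lra.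
  by nra.
(* For positive y the bound 1/(1 - y) has a pole at 1, so it is applied to y/2 and squared. *)
have -> : expR y = expR (y / 2) ^+ 2 by rewrite -expRM_natl mulrCA divff ?mulr1.
have H : expR (y / 2) ^+ 2 <= (1 - y / 2)^-1 ^+ 2.
  rewrite lerXn2r ?nnegrE ?expR_ge0// ?invr_ge0 ?(expR_le_inv (y / 2))//; lra.
apply: (le_trans H); rewrite exprVn -[leLHS]mul1r ler_pdivrMr; last nra.
(* One quarter of this product is (1 + y + 2y^2)(1 - y/2)^2 - 1. *)
have : 0 <= y ^+ 2 * ((1 - y) * (5 - 2 * y)) by rewrite mulr_ge0 ?sqr_ge0// mulr_ge0; lra.
by nra.
Qed.

Lemma expR_le_1DM y : 0 <= y <= 2 -> expR y <= 1 + expR 2 * y.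
Proof.
move=> /andP[y0 y2]; have : expR y * (1 - y) <= 1.
  have := expR_ge1Dx (- y); rewrite -(ler_pM2l (expR_gt0 y)) -expRD subrr expR0.
  by [].
have : expR y <= expR 2 by rewrite ler_expR.
have := expR_gt0 y; nra.
Qed.

End exp_bounds.

(** * The marginal density of an observation and the spike ratio *)

Section coordinates.
Variable R : realType.
Local Notation mu := (@lebesgue_measure R).
Local Notation phi0 := (@normal_peak R 1).
Implicit Types x u a : R.

Lemma measurable_phi_id : measurable_fun [set: R] (@phi R).
Proof. by have := measurable_phi _ (0 : R); under eq_fun do rewrite subr0. Qed.

Lemma measurable_gconv_id : measurable_fun [set: R] (@gconv R).
Proof. by have := measurable_gconv _ (0 : R); under eq_fun do rewrite subr0. Qed.

(** Density of one observation under the prior of weight [a]: the denominator of [post_a] and the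
    argument of the logarithm in [loglik]. *)
Definition marg a x : R := (1 - a) * phi x + a * gconv x.

Lemma marg_gt0 a x : 0 < a <= 1 -> 0 < marg a x.
Proof.
move=> /andP[a0 a1]; rewrite ltr_wpDl// ?mulr_gt0 ?gconv_gt0// mulr_ge0 ?subr_ge0//.
exact/ltW/phi_gt0.
Qed.

Lemma measurable_marg a : measurable_fun [set: R] (marg a).
Proof.
rewrite /marg; apply: measurable_funD; apply: measurable_funM => //.
  exact: measurable_phi_id.
exact: measurable_gconv_id.
Qed.

(** The function w of the overview. Since a times the derivative of log [marg] in a equals 1 - w,
    the quantity 1 - w is a rescaled score. *)
Definition spike_ratio a x := phi x / marg a x.

Lemma spike_ratio_ge0 a x : 0 < a <= 1 -> 0 <= spike_ratio a x.
Proof. by move=> /marg_gt0 H; rewrite divr_ge0 // ltW ?H ?phi_gt0. Qed.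

Lemma spike_ratio_le2 a x : 0 < a <= 2^-1 -> spike_ratio a x <= 2.
Proof.
move=> /andP[a0 a1]; rewrite ler_pdivrMr ?marg_gt0 ?a0//; last lra.
rewrite /marg; have := phi_gt0 _ x; have := gconv_gt0 _ x; nra.
Qed.

Lemma measurable_spike_ratio a : 0 < a <= 1 -> measurable_fun [set: R] (spike_ratio a).
Proof.
move=> a01; rewrite /spike_ratio; apply: measurable_funM.
  exact: measurable_phi_id.
rewrite (_ : (fun x => _) = (fun x => expR (- ln (marg a x)))).
  apply: measurableT_comp => //; apply: measurableT_comp => //.
  by apply: measurableT_comp => //; exact: measurable_marg.
by apply/funext => x; rewrite expRN lnK// posrE marg_gt0.
Qed.

(* Uses marg >= a g for |x| >= L and marg >= phi / 2 for |x| <= L: both give the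
   order c r e^-||x| - L|, and the right-hand side keeps it integrable in closed form. *)
Lemma slab_sq_le : exists2 C : R, 0 < C & forall c L r a x, 0 < c <= 2^-1 -> 6 <= L ->
  r = expR (- (L ^+ 2 / 2)) -> a = c * expR L * r ->
  (a * gconv x) ^+ 2 / marg a x <= C * (c * r) * (gconv (x - L) + gconv (x + L)).
Proof.
pose K := expR (2^-1) : R.
have K0 : 0 < K := expR_gt0 _.
have [k k0 gk] : exists2 k : R, 0 < k & forall x, k * expR (- `|x|) <= gconv x.
  exists (phi 1 * expR (-1) / 2); last exact: gconv_ge.
  by rewrite !mulr_gt0 ?expR_gt0 ?phi_gt0.
have p0 := phi0_gt0 R.
have D0 : 0 < 2 * K ^+ 2 / phi0 by rewrite !(divr_gt0, mulr_gt0, exprn_gt0).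
(* The first summand serves the region |x| >= L, the second the region |x| < L. *)
have [C1 C10 C1E] : exists2 C1, 0 < C1 & C1 = K + 2 * K ^+ 2 / phi0.
  by exists (K + 2 * K ^+ 2 / phi0) => //; rewrite addr_gt0.
exists (C1 / k); first exact: divr_gt0.
move=> c L r a x /andP[c0 c2] L6 rE aE.
have r0 : 0 < r by rewrite rE expR_gt0.
have a0 : 0 < a by rewrite aE !mulr_gt0 ?expR_gt0.
have eL4 : expR L * r <= 1 by rewrite rE -expRD expR_le1; nra.
have a2 : a <= 2^-1 by rewrite aE -mulrA; nra.
have m0 : 0 < marg a x by apply: marg_gt0; rewrite a0; lra.
have g0 := gconv_gt0 _ x.
have f0 := phi_gt0 _ x.
have gK : gconv x <= K * expR (- `|x|) := gconv_le _ x.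
have cr0 : 0 < c * r by exact: mulr_gt0.
apply: (@le_trans _ _ (C1 * (c * r) * expR (- `| `|x| - L|))); last first.
  (* The copy of g centred at whichever of L and -L has the sign of x already suffices. *)
  have : k * expR (- `| `|x| - L|) <= gconv (x - L) + gconv (x + L).
    have [x0|x0] := ger0P x.
      by apply: (le_trans (gk (x - L))); rewrite lerDl ltW ?gconv_gt0.
    have -> : `|- x - L| = `|x + L| by rewrite -normrN opprD !opprK.
    by apply: (le_trans (gk (x + L))); rewrite lerDr ltW ?gconv_gt0.
  move: (gconv (x - L) + gconv (x + L)) (expR _) => G E kEG.
  have -> : C1 / k * (c * r) * G = C1 * (c * r) * (k^-1 * G) by ring.
  by rewrite ler_pM2l ?(mulr_gt0 C10 cr0)// ler_pdivlMl.
have [xL|xL] := leP L `|x|.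
  apply: (@le_trans _ _ (a * gconv x)).
    rewrite ler_pdivrMr// expr2 ler_pM2l ?mulr_gt0// /marg.
    by rewrite lerDr mulr_ge0 ?ltW//; lra.
  rewrite ger0_norm ?subr_ge0//.
  apply: (@le_trans _ _ (a * (K * expR (- `|x|)))); first by rewrite ler_pM2l.
  rewrite [leLHS](_ : _ = K * (c * r) * expR (- (`|x| - L))); last first.
    by rewrite aE opprB addrC expRD; ring.
  by rewrite !ler_pM2r ?expR_gt0// C1E lerDl ltW.
rewrite ltr0_norm ?subr_lt0// opprK.
apply: (@le_trans _ _ (2 * (K ^+ 2 / phi0) * (c * r) * expR (`|x| - L))); last first.
  by rewrite !ler_pM2r ?expR_gt0// C1E mulrA lerDr ltW.
rewrite ler_pdivrMr//.
apply: (@le_trans _ _ ((a * (K * expR (- `|x|))) ^+ 2)).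
  by rewrite lerXn2r ?nnegrE ?ler_pM2l// ?mulr_ge0 ?expR_ge0// ltW.
have mf : phi x / 2 <= marg a x by rewrite /marg; nra.
apply: (@le_trans _ _ (2 * (K ^+ 2 / phi0) * (c * r) * expR (`|x| - L) * (phi x / 2))); last first.
  rewrite ler_pM2l// mulr_gt0 ?expR_gt0// mulr_gt0// mulrA.
  exact: D0.
rewrite phiE [leRHS](_ : _ = K ^+ 2 * c * (r * expR (`|x| - L) * expR (- (x ^+ 2 / 2)))); last first.
  by field; exact: lt0r_neq0.
rewrite [leLHS](_ : _ = K ^+ 2 * c * (c * (expR L ^+ 2 * r ^+ 2 * expR (- `|x|) ^+ 2))); last first.
  by rewrite aE; ring.
rewrite ler_pM2l; last by rewrite mulr_gt0// exprn_gt0.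
rewrite -!expRM_natl rE -expRM_natl -!expRD.
apply: (@le_trans _ _ (1 * expR (2 * L + 2 * - (L ^+ 2 / 2) + 2 * - `|x|))).
  by rewrite ler_pM2r ?expR_gt0//; lra.
rewrite mul1r ler_expR -[x ^+ 2]real_normK ?num_real//.
(* The difference of the two exponents factors as this product, nonnegative because |x| < L and L >=
   6. *)
have : 0 <= (L - `|x|) * ((L + `|x|) / 2 - 3).
  by rewrite mulr_ge0//; have := normr_ge0 x; lra.
by nra.
Qed.

End coordinates.

(** * Exponential moments of the score at null and signal coordinates *)

Section score.
Variable R : realType.
Local Notation mu := (@lebesgue_measure R).
Local Notation phi0 := (@normal_peak R 1).
Implicit Types x u a : R.

Lemma measurable_exp_score a : 0 < a <= 1 ->
  measurable_fun [set: R] (fun x => expR (spike_ratio _ a x - 1)).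
Proof.
move=> a01; apply: measurableT_comp => //; apply: measurable_funB => //.
exact: measurable_spike_ratio.
Qed.

(* The term a g on the left makes all integrands nonnegative: integrated, it cancels
   the first-order term a phi on the right, since g and phi have the same mass. *)
Lemma null_score_pointwise a x : 0 < a <= 2^-1 ->
  expR (spike_ratio _ a x - 1) * phi x + a * gconv x <=
  (1 + a + 10 * a ^+ 2) * phi x + 5 * ((a * gconv x) ^+ 2 / marg _ a x).
Proof.
move=> a02; have /andP[a0 a2] := a02.
have a01 : 0 < a <= 1 by rewrite a0; lra.
have f0 := marg_gt0 _ a x a01; have w0 := spike_ratio_ge0 _ a x a01.
have w2 := spike_ratio_le2 _ a x a02.
have p0 := phi_gt0 _ x; have g0 := gconv_gt0 _ x.
set f := marg _ a x in f0 *; set w := spike_ratio _ a x in w0 w2 *.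
have wf : phi x = w * f by rewrite /w /spike_ratio divfK// lt0r_neq0.
have ag : a * gconv x = f - (1 - a) * phi x by rewrite /f /marg; ring.
have q : expR (w - 1) <= w + 2 * (w - 1) ^+ 2.
  by apply: (le_trans (expR_le_quad _ (w - 1) _)); lra.
have s1 : expR (w - 1) * phi x + a * gconv x <= (1 + a) * phi x + 5 * ((w - 1) ^+ 2 * f).
  apply: (@le_trans _ _ ((w + 2 * (w - 1) ^+ 2) * phi x + a * gconv x)).
    by rewrite lerD2r ler_pM2r.
  rewrite ag wf.
  have : 0 <= (2 - w) * ((w - 1) ^+ 2 * f)
    by apply: mulr_ge0; [lra|apply: mulr_ge0; [exact: sqr_ge0|exact: ltW]].
  by nra.
apply: (le_trans s1).
have -> : (1 + a + 10 * a ^+ 2) * phi x = (1 + a) * phi x + 5 * (2 * a ^+ 2 * phi x) by ring.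
rewrite -addrA lerD2l -mulrDr ler_pM2l//.
have E : (w - 1) ^+ 2 * f = (a * (phi x - gconv x)) ^+ 2 / f.
  have -> : a * (phi x - gconv x) = (w - 1) * f by rewrite mulrBr ag wf; ring.
  by field; exact: lt0r_neq0.
rewrite E; apply: (@le_trans _ _ (((a * phi x) ^+ 2 + (a * gconv x) ^+ 2) / f)).
  rewrite ler_pM2r ?invr_gt0//.
  have : 0 <= (a * phi x) * (a * gconv x) by rewrite !mulr_ge0// ltW.
  by nra.
rewrite mulrDl lerD2r wf.
have -> : (a * (w * f)) ^+ 2 / f = a ^+ 2 * (w * f) * w by field; exact: lt0r_neq0.
rewrite -wf; have : 0 <= (2 - w) * (a ^+ 2 * phi x)
  by apply: mulr_ge0; [lra|apply: mulr_ge0; [exact: sqr_ge0|exact: ltW]].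
by nra.
Qed.

(** Integrates the pointwise bound, with [slab_sq_le] for its last term. The excess over 1 has order
    c r, so n null coordinates together cost a factor of at most e^{C c s}. *)
Lemma null_score_le : exists2 C : R, 0 < C & forall c L r a, 0 < c <= 2^-1 -> 6 <= L ->
  r = expR (- (L ^+ 2 / 2)) -> a = c * expR L * r ->
  (\int[mu]_x (expR (spike_ratio _ a x - 1) * phi x)%:E <= (1 + C * (c * r))%:E)%E.
Proof.
have [C C0 HC] := slab_sq_le R.
exists (10 + 10 * C); first lra.
move=> c L r a c02 L6 rE aE; have /andP[c0 c2] := c02.
have r0 : 0 < r by rewrite rE expR_gt0.
have a0 : 0 < a by rewrite aE !mulr_gt0 ?expR_gt0.
(* From L >= 6 one has 2L <= L^2/2; this makes a^2 at most c r. *)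
have eL4 : expR L ^+ 2 * r <= 1 by rewrite rE -expRM_natl -expRD expR_le1; nra.
have eL1 : 1 <= expR L by rewrite -expR0 ler_expR; lra.
have a2 : a <= c.
  rewrite aE -mulrA ler_piMr ?(ltW c0)//; apply: (le_trans _ eL4).
  by rewrite ler_pM2r// expr2 ler_peMr// ltW ?expR_gt0.
have acr : a ^+ 2 <= c * r.
  have -> : a ^+ 2 = (c * r) * (c * (expR L ^+ 2 * r)) by rewrite aE; ring.
  rewrite ler_piMr ?mulr_ge0 ?(ltW c0) ?(ltW r0)//.
  have := expR_gt0 L; nra.
have a01 : 0 < a <= 1 by rewrite a0; lra.
have a02 : 0 < a <= 2^-1 by rewrite a0; lra.
(* The mass of one normal density and two shifted copies of g, minus the mass a of a g, as
   [integral_le_sub] requires. *)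
have -> : 1 + (10 + 10 * C) * (c * r) = (1 + a + 10 * (c * r)) * 1 +
  1 * ((5 * (C * (c * r))) * 1 + (5 * (C * (c * r))) * 1) - a by ring.
have cr0 : 0 <= c * r by rewrite mulr_ge0// ltW.
have k0 : 0 <= 5 * (C * (c * r)) by rewrite !mulr_ge0// ltW.
have g0 x : 0 <= gconv x by apply/ltW/gconv_gt0.
have p0 x : 0 <= phi x :> R by apply/ltW/phi_gt0.
apply: (integral_le_sub _ _ (fun x => a * gconv x)
  (fun x => (1 + a + 10 * (c * r)) * phi (x - 0) +
    1 * (5 * (C * (c * r)) * gconv (x - L) + 5 * (C * (c * r)) * gconv (x - (- L))))).
- by apply: measurable_funM; [exact: measurable_exp_score|exact: measurable_phi_id].
- by apply: measurable_funM => //; exact: measurable_gconv_id.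
- by move=> x; rewrite mulr_ge0 ?expR_ge0.
- by move=> x; rewrite mulr_ge0 // ltW.
- move=> x; apply: (le_trans (null_score_pointwise a x a02)).
  rewrite subr0 opprK mul1r -mulrDr; apply: lerD.
    by rewrite ler_wpM2r// lerD2l; lra.
  by rewrite -mulrA ler_pM2l//; exact: HC.
- have := integral_lincomb _ (fun x => gconv (x - 0)) (fun x => gconv (x - 0)) a 0 1 1 (ltW a0) (lexx _)
   (measurable_gconv _ _) (measurable_gconv _ _) (fun x => g0 _) (fun x => g0 _)
   (integral_gconv _ _) (integral_gconv _ _).
  under eq_integral do rewrite mul0r addr0 subr0.
  by move=> ->; rewrite mul0r addr0 mulr1.
rewrite (integral_lincomb _ _ _ _ _ 1 ((5 * (C * (c * r))) * 1 + (5 * (C * (c * r))) * 1)) ?lexx//.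
- by rewrite addr_ge0 ?mulr_ge0//; lra.
- exact: measurable_phi.
- by apply: measurable_funD; apply: measurable_funM => //; exact: measurable_gconv.
- by move=> x; rewrite addr_ge0// mulr_ge0.
- exact: integral_phi.
- apply: (integral_lincomb _ _ _ _ _ 1 1 k0 k0 (measurable_gconv _ L) (measurable_gconv _ (- L))
    _ _ (integral_gconv _ L) (integral_gconv _ (- L))) => x; exact: g0.
Qed.

(** Since w <= C [lap], the mean of w under N(A, 1) is at most C g(A), which is small for large A.
    With e^w <= 1 + e^2 w the mean is at most e^{-1}(1 + 1/2) <= e^{-1/2}. The mean A depends on
    a. *)
Lemma signal_score_le a : 0 < a <= 2^-1 -> exists A : R,
  (\int[mu]_x (expR (spike_ratio _ a x - 1) * phi (x - A))%:E <= (expR (- 2^-1))%:E)%E.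
Proof.
move=> a02; have /andP[a0 a2] := a02; have a01 : 0 < a <= 1 by rewrite a0; lra.
pose k := phi 1 * expR (-1) / 2 : R.
have k0 : 0 < k by rewrite !mulr_gt0 ?expR_gt0 ?phi_gt0.
have [C C0 CE] : exists2 C : R, 0 < C & C = 2 * phi0 * expR 2 / (a * k).
  eexists; last reflexivity.
  by apply: divr_gt0; apply: mulr_gt0 => //; rewrite ?expR_gt0 ?mulr_gt0 ?phi0_gt0.
have p0 x : 0 < phi x :> R by exact: phi_gt0.
have D0 : 0 < 2 * (expR 2 * C * expR 2^-1).
  by rewrite mulr_gt0// mulr_gt0 ?expR_gt0// mulr_gt0 ?expR_gt0.
(* The choice A = |z| gives e^{-A} <= e^z, so z may have either sign. *)
have [z Hz] : exists z, expR z = (2 * (expR 2 * C * expR 2^-1))^-1.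
  by apply: expR_total; rewrite invr_gt0.
pose A : R := `|z|.
have gA : expR 2 * C * gconv A <= 2^-1.
  apply: (@le_trans _ _ (expR 2 * C * (expR 2^-1 * expR z))).
    rewrite ler_pM2l ?mulr_gt0 ?expR_gt0//; apply: (le_trans (gconv_le _ _)).
    rewrite ler_pM2l ?expR_gt0// ler_expR /A normr_id.
    by have := lerNnormlW (lexx `|z|); lra.
  rewrite mulrA Hz -ler_pdivlMr ?invr_gt0// invrK.
  lra.
exists A.
apply: (@le_trans _ _ (\int[mu]_x (expR (-1) * phi (x - A) +
  (expR (-1) * (expR 2 * C)) * (phi (A - x) * lap x))%:E)%E).
  apply: le_integral_EFin => x; rewrite mulr_ge0 ?expR_ge0 ?(ltW (p0 _))//=.
  have w0 := spike_ratio_ge0 _ a x a01.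
  have w2 := spike_ratio_le2 _ a x a02.
  apply: (@le_trans _ _ (expR (-1) * (1 + expR 2 * spike_ratio _ a x) * phi (x - A))).
    rewrite ler_pM2r// addrC expRD ler_pM2l ?expR_gt0//.
    by apply: expR_le_1DM; rewrite w0.
  rewrite mulrDr mulr1 mulrDl lerD2l -!mulrA ler_pM2l ?expR_gt0//.
rewrite -[A - x]opprB phiN ler_pM2l ?expR_gt0// mulrA [leRHS]mulrCA mulrC ler_pM2l//.
  have m0 := marg_gt0 _ a x a01.
  rewrite ler_pdivrMr//.
  apply: (@le_trans _ _ (C * lap x * (a * (k * expR (- `|x|))))); last first.
    rewrite ler_pM2l ?mulr_gt0 ?lap_gt0// /marg; apply: (@le_trans _ _ (a * gconv x)).
      by rewrite ler_pM2l// gconv_ge.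
    by rewrite lerDr mulr_ge0 ?(ltW (p0 _))//; lra.
  have -> : C * lap x * (a * (k * expR (- `|x|))) = phi0 * expR 2 * expR (- `|x|) * expR (- `|x|).
    by rewrite CE /lap; field; rewrite !lt0r_neq0.
  rewrite [X in _ <= _ * X]expRN ler_pdivlMr ?expR_gt0//.
  exact: phi_expR_norm.
have lapE : (\int[mu]_u (phi (A - u) * lap u)%:E = (gconv A)%:E)%E by rewrite gconvE.
rewrite (integral_lincomb _ _ _ _ _ 1 (gconv A)) ?integral_phi//.
- rewrite lee_fin mulr1 -mulrA.
  have -> : - 2^-1 = - 1 + 2^-1 :> R by field.
  rewrite [leRHS]expRD [leLHS](_ : _ = expR (- 1) * (1 + expR 2 * C * gconv A)); last by ring.
  rewrite ler_pM2l ?expR_gt0//.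
  by have := expR_ge1Dx (2^-1 : R); lra.
- by rewrite !mulr_ge0 ?expR_ge0// ltW.
- exact: measurable_phi.
- exact: measurable_phi_lap.
- by move=> x; rewrite ltW.
- by move=> x; exact: phi_lap_ge0.
Qed.

End score.

(** * The posterior of one coordinate, and integration over its observation *)

Section coordinate_posterior.
Variable R : realType.
Local Notation mu := (@lebesgue_measure R).
Local Notation phi0 := (@normal_peak R 1).
Implicit Types x u a : R.

Lemma gam_ge0 x u : 0 <= gam_x x u.
Proof. by rewrite divr_ge0 ?phi_lap_ge0// ltW ?gconv_gt0. Qed.

Lemma measurable_gam x : measurable_fun [set: R] (gam_x x).
Proof. by apply: measurable_funM => //; exact: measurable_phi_lap. Qed.

Lemma integral_gam x : (\int[mu]_u (gam_x x u)%:E = 1)%E.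
Proof.
have := @integral_lincomb R _ _ (gconv x)^-1 0 (gconv x) (gconv x) _ (lexx _)
  (measurable_phi_lap _ x) (measurable_phi_lap _ x) (phi_lap_ge0 _ x) (phi_lap_ge0 _ x)
  (esym (gconvE _ x)) (esym (gconvE _ x)).
have g0 := gconv_gt0 _ x.
rewrite mul0r addr0 mulVf ?lt0r_neq0// => <-; last by rewrite invr_ge0 ltW.
by apply: eq_integral => u _; rewrite mul0r addr0 mulrC.
Qed.

Lemma post_a_marg a x : post_a a x = a * gconv x / marg _ a x.
Proof. by []. Qed.

Lemma post_a_01 a x : 0 < a <= 1 -> 0 <= post_a a x <= 1.
Proof.
move=> a01; have m0 := marg_gt0 _ a x a01; have /andP[a0 a1] := a01.
have g0 := gconv_gt0 _ x; have p0 := phi_gt0 _ x.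
rewrite post_a_marg; apply/andP; split.
  by rewrite divr_ge0 ?mulr_ge0 ?(ltW a0) ?(ltW g0) ?(ltW m0).
by rewrite ler_pdivrMr// mul1r /marg lerDr mulr_ge0 ?subr_ge0// ltW.
Qed.

(** Supplies the one-coordinate hypothesis of [iter_int_le] for the posterior: the atom contributes
    [psi 0], the slab at most [J]. The integrand [h] enters only through its pointwise bound. *)
Lemma post_int_le a x (psi : R -> R) (b J p : R) (h : R -> \bar R) :
  0 < a <= 1 -> 0 <= b -> measurable_fun [set: R] psi -> (forall u, 0 <= psi u) ->
  (forall u, 0 <= h u <= (b * psi u)%:E)%E ->
  (\int[mu]_u (psi u * gam_x x u)%:E <= J%:E)%E ->
  (1 - post_a a x) * psi 0 + post_a a x * J <= p ->
  (0 <= post_int a x h <= (b * p)%:E)%E.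
Proof.
move=> a01 b0 mpsi psi0 hpsi HJ Hp; have /andP[A0 A1] := post_a_01 a x a01.
have h0 u : (0 <= h u)%E by have /andP[] := hpsi u.
have I0 : (0 <= \int[mu]_u (h u * (gam_x x u)%:E))%E.
  by apply: integral_ge0 => u _; rewrite mule_ge0// lee_fin gam_ge0.
have A1' : (0 <= (1 - post_a a x)%:E)%E by rewrite lee_fin subr_ge0.
rewrite /post_int; apply/andP; split.
  by rewrite adde_ge0// mule_ge0// lee_fin.
have HI : (\int[mu]_u (h u * (gam_x x u)%:E) <= (b * J)%:E)%E.
  apply: (@le_trans _ _ (\int[mu]_u (b%:E * (psi u * gam_x x u)%:E))%E).
    apply: ge0_le_integral_nomeas => u; rewrite mule_ge0 ?lee_fin ?gam_ge0//=.
    rewrite [X in (_ <= _ * X)%E]EFinM [leRHS]muleA.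
 apply: lee_wpmul2r; first by rewrite lee_fin gam_ge0.
    by rewrite -EFinM; have /andP[] := hpsi u.
  rewrite ge0_integralZl//.
  - by rewrite [leRHS]EFinM; exact: lee_wpmul2l.
  - apply: measurableT_comp => //; apply: measurable_funM => //; exact: measurable_gam.
  - by move=> u _; rewrite lee_fin mulr_ge0 ?gam_ge0.
have /andP[_ h0b] := hpsi 0.
apply: (@le_trans _ _ ((1 - post_a a x)%:E * (b * psi 0)%:E + (post_a a x)%:E * (b * J)%:E)%E).
  by apply: leeD; apply: lee_wpmul2l => //; rewrite lee_fin.
rewrite -!EFinM -EFinD lee_fin mulrCA [X in _ + X]mulrCA -mulrDr.
exact: ler_wpM2l.
Qed.

Lemma post_int_le_cst a x b (h : R -> \bar R) : 0 < a <= 1 -> 0 <= b ->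
  (forall u, 0 <= h u <= b%:E)%E -> (0 <= post_int a x h <= b%:E)%E.
Proof.
move=> a01 b0 hb; rewrite -[b]mulr1.
apply: (@post_int_le a x (cst 1) b 1) => //=.
- by move=> u; rewrite mulr1.
- by under eq_integral do rewrite mul1r; rewrite integral_gam.
- by rewrite !mulr1 subrK.
Qed.

(** The slab part charges [1, 2], where e^{-u^2} stays away from 1, so it loses at least d/g(x).
    Weighted by [post_a] the loss is a d / [marg], of order a. *)
Lemma post_int_null : exists2 c : R, 0 < c <= 1 & forall a b x h,
  0 < a <= 1 -> `|x| <= 1 -> 0 <= b ->
  (forall u, 0 <= h u <= (b * expR (- u ^+ 2))%:E)%E ->
  (0 <= post_int a x h <= (b * (1 - c * a))%:E)%E.
Proof.
pose e : R := 1 - expR (-1).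
have e0 : 0 < e by rewrite subr_gt0 expR_lt1; lra.
have e1 : e <= 1 by rewrite gerBl expR_ge0.
pose d : R := e * (phi 3 * lap 2).
have pl0 : 0 < phi 3 * lap 2 :> R by rewrite mulr_gt0 ?phi_gt0 ?lap_gt0.
have d0 : 0 < d by rewrite mulr_gt0.
pose k : R := expR (2^-1).
have k0 : 0 < k by exact: expR_gt0.
have p0 := phi0_gt0 R.
have lap1 u : lap u <= 1 :> R.
  rewrite /lap ler_pdivrMr// mul1r; apply: (@le_trans _ _ 1); last lra.
  by rewrite expR_le1 oppr_le0.
(* [phi0 + k] bounds the marginal density, as phi <= [phi0] and g <= [k]. *)
exists (d / (phi0 + k)).
  rewrite divr_gt0 ?addr_gt0//= ler_pdivrMr ?addr_gt0// mul1r.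
  apply: (@le_trans _ _ phi0); last by rewrite lerDl ltW.
  have := phi_le _ (3 : R); have := lap1 2; have := phi_gt0 _ (3:R); have := lap_gt0 _ (2:R).
  rewrite /d; nra.
move=> a b x h a01 x1 b0 hb; have /andP[a0 a1] := a01.
have g0 := gconv_gt0 _ x; have m0 := marg_gt0 _ a x a01.
pose psi u : R := expR (- u ^+ 2).
have mpsi : measurable_fun [set: R] psi.
  by apply: measurableT_comp => //; apply: measurableT_comp => //; exact: measurable_funX.
have psi1 u : psi u <= 1 by rewrite expR_le1 oppr_le0 sqr_ge0.
apply: (@post_int_le a x psi b (1 - d / gconv x)) => //.
- by move=> u; exact: expR_ge0.
- apply: (@integral_le_sub R (fun u => psi u * gam_x x u) (fun u => (1 - psi u) * gam_x x u) (gam_x x)).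
  + by apply: measurable_funM => //; exact: measurable_gam.
  + by apply: measurable_funM; [exact: measurable_funB|exact: measurable_gam].
  + by move=> u; rewrite mulr_ge0 ?expR_ge0 ?gam_ge0.
  + by move=> u; rewrite mulr_ge0 ?subr_ge0 ?gam_ge0.
  + by move=> u; rewrite -mulrDl addrC subrK mul1r.
  (* On [1, 2] one has 1 - e^{-u^2} >= [e], |x - u| <= 3 and |u| <= 2. *)
  + apply: (@integral_ge_itv R _ 1).
    * by rewrite divr_ge0 ?ltW.
    * by move=> u; rewrite mulr_ge0 ?subr_ge0 ?gam_ge0.
    move=> u /andP[u1 u2]; rewrite /gam_x mulrA ler_pM2r ?invr_gt0// /d.
    apply: ler_pM; rewrite ?(ltW e0) ?(ltW pl0)//.
      by rewrite lerD2l lerN2 ler_expR lerN2; nra.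
    apply: ler_pM; rewrite ?(ltW (phi_gt0 _ _)) ?(ltW (lap_gt0 _ _))//.
      by apply: phi_ge; move: x1; rewrite !ler_norml => /andP[]; lra.
    by rewrite /lap ler_pM2r// ler_expR lerN2 !ger0_norm; lra.
  + by rewrite integral_gam.
rewrite /psi expr0n /= oppr0 expR0 mulr1.
have -> : 1 - post_a a x + post_a a x * (1 - d / gconv x) = 1 - a * d / marg _ a x.
  by rewrite post_a_marg; field; rewrite !lt0r_neq0.
rewrite lerD2l lerN2 mulrAC [d * a]mulrC ler_pM2l ?(mulr_gt0 a0 d0)//.
rewrite lef_pV2 ?posrE ?(addr_gt0 p0 k0)// /marg.
have gk : gconv x <= k.
  apply: (le_trans (gconv_le _ x)).
  by rewrite ler_piMr ?(ltW k0)// expR_le1 oppr_le0.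
have := phi_le _ x; have := phi_gt0 _ x; nra.
Qed.

(** The counterpart of [post_int_le] for the law of one observation, with both terms of
    [iter_int_le]. *)
Lemma normal_int_le (t p q : R) (psi chi : R -> R) :
  measurable_fun [set: R] psi -> measurable_fun [set: R] chi ->
  (forall x, 0 <= psi x) -> (forall x, 0 <= chi x) ->
  (\int[mu]_x (psi x * phi (x - t))%:E <= p%:E)%E ->
  (\int[mu]_x (chi x * phi (x - t))%:E <= q%:E)%E ->
  forall a b (h : R -> \bar R), 0 <= a -> 0 <= b ->
  (forall x, 0 <= h x <= (a * psi x + b * chi x)%:E)%E ->
  (0 <= \int[normal_prob t 1]_x h x <= (a * p + b * q)%:E)%E.
Proof.
move=> mpsi mchi psi0 chi0 Hp Hq a b h a0 b0 Hh.
apply/andP; split; first by apply: integral_ge0 => x _; have /andP[] := Hh x.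
have mE (c : R) (f : R -> R) : measurable_fun [set: R] f -> measurable_fun [set: R] (fun x => (c * f x)%:E).
  by move=> mf; apply: measurableT_comp => //; exact: measurable_funM.
apply: (@le_trans _ _ (\int[normal_prob t 1]_x ((a * psi x)%:E + (b * chi x)%:E))%E).
  by apply: ge0_le_integral_nomeas => x; rewrite -EFinD.
have H (c : R) (f : R -> R) (v : R) : 0 <= c -> measurable_fun [set: R] f -> (forall x, 0 <= f x) ->
    (\int[mu]_x (f x * phi (x - t))%:E <= v%:E)%E ->
    (\int[normal_prob t 1]_x (c * f x)%:E <= (c * v)%:E)%E.
  move=> c0 mf f0 fv; under eq_integral do rewrite EFinM.
  rewrite ge0_integralZl//; [|exact: measurableT_comp|by move=> x _; rewrite lee_fin].
  rewrite [leRHS]EFinM; apply: lee_wpmul2l; first by rewrite lee_fin.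
  rewrite (integral_normal_prob R t f mf f0).
  by under eq_integral do rewrite normal_pdf_phi.
rewrite ge0_integralD//; [|by move=> x _; rewrite lee_fin mulr_ge0|exact: mE
  |by move=> x _; rewrite lee_fin mulr_ge0|exact: mE].
by rewrite EFinD leeD ?H.
Qed.

Lemma integral_thinned_phi (k : R) : 0 <= k <= 1 ->
  (\int[mu]_x ((1 - k * \1_(`[0, 1]%classic) x) * phi (x - 0))%:E <= (1 - k * phi 1)%:E)%E.
Proof.
move=> /andP[k0 k1].
have i01 x : 0 <= (\1_(`[0, 1]%classic) x : R) <= 1 by rewrite indicE ler0n lern1 leq_b1.
have p0 x : 0 <= phi x :> R by rewrite ltW ?phi_gt0.
have mi : measurable_fun [set: R] (fun x : R => k * \1_(`[0, 1]%classic) x : R).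
  exact: measurable_funM.
apply: (@integral_le_sub R _ (fun x => k * \1_(`[0, 1]%classic) x * phi (x - 0)) (fun x => phi (x - 0))).
- by apply: measurable_funM; [exact: measurable_funB|exact: measurable_phi].
- by apply: measurable_funM => //; exact: measurable_phi.
- by move=> x; rewrite mulr_ge0// subr_ge0; have := i01 x; nra.
- by move=> x; rewrite !mulr_ge0//; have /andP[] := i01 x.
- by move=> x; rewrite -mulrDl subrK mul1r.
- apply: (@integral_ge_itv R _ 0).
  + by rewrite mulr_ge0.
  + by move=> x; rewrite !mulr_ge0//; have /andP[] := i01 x.
  move=> u; rewrite add0r => u01; rewrite indicE mem_set/= ?in_itv//= mulr1 subr0.
  rewrite ler_wpM2l// phi_ge// ger0_norm; case/andP: u01 => //.
by rewrite integral_phi.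
Qed.

End coordinate_posterior.

(** * From single coordinates to the whole vector *)

Section assembly.
Variable R : realType.
Local Notation mu := (@lebesgue_measure R).

(** By ln(1 + y) <= y, the log-likelihood at a lies below its tangent at b. If it is no smaller at a
    < b than at b, the slope at b cannot be positive. *)
Lemma score_le0 n (x : n.-tuple R) (a b : R) : 0 < a < b -> b <= 1 ->
  loglik x b <= loglik x a -> \sum_(i < n) (1 - spike_ratio _ b (tnth x i)) <= 0.
Proof.
move=> /andP[a0 ab] b1 ll.
have b0 : 0 < b := lt_trans a0 ab.
have H i : ln (marg _ a (tnth x i)) <= ln (marg _ b (tnth x i)) +
    (a - b) / b * (1 - spike_ratio _ b (tnth x i)).
  set y := tnth x i.
  have ma : 0 < marg _ a y by apply: marg_gt0; rewrite a0; lra.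
  have mb : 0 < marg _ b y by apply: marg_gt0; rewrite b0.
  have E : marg _ a y = marg _ b y * (1 + (a - b) / b * (1 - spike_ratio _ b y)).
    by rewrite /spike_ratio; move: (mb); rewrite /marg => mb'; field; rewrite !lt0r_neq0.
  have pos : 0 < 1 + (a - b) / b * (1 - spike_ratio _ b y).
    by rewrite -(pmulr_rgt0 _ mb) -E.
  rewrite E lnM ?posrE// lerD2l; apply: le_ln1Dx; lra.
have : loglik x a <= loglik x b + (a - b) / b * \sum_(i < n) (1 - spike_ratio _ b (tnth x i)).
  by rewrite mulr_sumr -big_split; apply: ler_sum => i _; exact: H.
move=> {}H; have : 0 <= (a - b) / b * \sum_(i < n) (1 - spike_ratio _ b (tnth x i)) by lra.
by rewrite nmulr_rge0// pmulr_llt0 ?invr_gt0// subr_lt0.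
Qed.

Lemma sum_ord_lt_if n s (a b : R) : (s <= n)%N ->
  \sum_(i < n) (if (i < s)%N then a else b) = s%:R * a + (n - s)%:R * b.
Proof.
move=> /subnKC <-; rewrite addKn big_split_ord /=; congr (_ + _).
  rewrite (eq_bigr (fun=> a)); last by move=> i _; rewrite ltn_ord.
  by rewrite sumr_const card_ord mulr_natl.
rewrite (eq_bigr (fun=> b)); last by move=> i _; rewrite ltnNge leq_addr.
by rewrite sumr_const card_ord mulr_natl.
Qed.

Lemma prod_le_expR_if n s (p : nat -> R) (a b : R) : (s <= n)%N ->
  (forall i, 0 <= p i <= expR (if (i < s)%N then a else b)) ->
  \prod_(i < n) p i <= expR (s%:R * a + (n - s)%:R * b).
Proof.
move=> sn pab; rewrite -(sum_ord_lt_if _ _ a b sn) expR_sum.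
by apply: ler_prod => i _; exact: pab.
Qed.

Lemma post_prob_le1 n (x : n.-tuple R) (a : R) B : 0 < a <= 1 ->
  (0 <= post_prob a x B <= 1)%E.
Proof.
move=> a01.
have := @iter_int_le R n (fun i => post_int a (nth 0 x i)) (fun _ => cst 1) (fun _ => cst 0)
  (fun=> 1) (fun=> 0) 1 0 (fun th => (\1_B th)%:E).
rewrite /= big1_eq mul1r mul0r addr0; apply => //.
  move=> i _ b c h b0 c0 /= hb; rewrite mulr1 mulr0 addr0; apply: post_int_le_cst => // u.
  by have := hb u; rewrite mulr1 mulr0 addr0.
move=> t; rewrite /=.
by rewrite !lee_fin indicE ler0n lern1 leq_b1.
Qed.

(* Bounds the posterior mean of exp(-(theta_i - theta_{0,i})^2) at X_i = x; the first
   s coordinates carry the signals. *)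
Definition thin (s : nat) (k : R) (i : nat) (x : R) : R :=
  if (i < s)%N then 1 else 1 - k * \1_(`[0, 1]%classic) x.

Lemma thin_ge0 s k i x : 0 <= k <= 1 -> 0 <= thin s k i x.
Proof.
move=> /andP[k0 k1]; rewrite /thin; case: ifP => // _.
by rewrite subr_ge0 indicE; case: (_ \in _); rewrite ?mulr1 ?mulr0.
Qed.

Lemma measurable_thin s k i : measurable_fun [set: R] (thin s k i).
Proof.
rewrite /thin; case: (i < s)%N; first exact: measurable_cst.
by apply: measurable_funB => //; exact: measurable_funM.
Qed.

(** The bound uses a lower bound [b] of the weight, so it remains a product of one-coordinate
    functions of [x] when the weight itself depends on [x]. *)
Lemma post_ball_le : exists2 c : R, 0 < c <= 1 &
  forall n s (x th : n.-tuple R) (a b M : R), 0 < b <= a -> a <= 1 ->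
  (forall i, (s <= i)%N -> nth 0 th i = 0) ->
  (0 <= post_prob a x [set u | (sqdist u th <= M)%R] <=
    (expR M * \prod_(i < n) thin s (c * b) i (tnth x i))%:E)%E.
Proof.
have [c c01 Hc] := post_int_null R; exists c => // n s x th a b M /andP[b0 ba] a1 th0.
have /andP[c0 c1] := c01.
have a01 : 0 < a <= 1 by rewrite a1 (lt_le_trans b0).
have := @iter_int_le R n (fun i => post_int a (nth 0 x i))
  (fun i u => expR (- (u - nth 0 th i) ^+ 2)) (fun _ => cst 0)
  (fun i => thin s (c * b) i (nth 0 x i)) (fun=> 0) (expR M) 0
  (fun u => (\1_[set u | (sqdist u th <= M)%R] u)%:E).
under eq_bigr do rewrite -tnth_nth.
rewrite mul0r addr0; apply => //.
- move=> i _ b' c' h b0' c0' hb; rewrite mulr0 addr0.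
  have {}hb u : (0 <= h u <= (b' * expR (- (u - nth 0 th i) ^+ 2))%:E)%E.
    by have := hb u; rewrite mulr0 addr0.
  have hb1 u : (0 <= h u <= b'%:E)%E.
    have /andP[-> h1] /= := hb u; apply: (le_trans h1).
    by rewrite lee_fin ler_piMr// expR_le1 oppr_le0 sqr_ge0.
  (* Signal coordinates, and null ones observed outside [0, 1], get the trivial factor 1. *)
  rewrite /thin; case: ltnP => si; first by rewrite mulr1; exact: post_int_le_cst.
  rewrite indicE; have [|_] := boolP (_ \in _); last first.
    by rewrite mulr0 subr0 mulr1; exact: post_int_le_cst.
  rewrite inE /= in_itv /= mulr1 => /andP[x0 x1].
  have /andP[-> H] : (0 <= post_int a (nth 0%R x i) h <= (b' * (1 - c * a))%:E)%E.
    apply: Hc => //; first by rewrite ger0_norm.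
    by move=> u; have := hb u; rewrite th0// subr0.
  apply: (le_trans H); rewrite lee_fin ler_wpM2l// lerD2l lerN2.
  by rewrite ler_pM2l.
move=> u; rewrite addr0 !lee_fin indicE ler0n /=.
under eq_bigr do rewrite -tnth_nth.
rewrite -expR_sum -expRD; have [|_] := boolP (_ \in _); last exact: expR_ge0.
rewrite inE /= => uM; rewrite -[leLHS]expR0 ler_expR sumrN subr_ge0.
exact: uM.
Qed.

(** Nonasymptotic form of the theorem; [m] is chosen before n, s and the estimator. *)
Lemma expect_ball_le : exists2 m : R, 0 < m & forall n s (an : R) (ahat : n.-tuple R -> R),
  0 < an ->
  (forall x, an <= ahat x <= 1 /\
    forall b, an <= b <= 1 -> loglik x b <= loglik x (ahat x)) ->
  (0 < s)%N -> (s * 2 <= n)%N -> 6 <= Num.sqrt (2 * ln (n%:R / s%:R : R)) ->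
  exists th : n.-tuple R, ell0 s th /\
   (0 <= expect th (fun x => post_prob (ahat x) x [set u | (sqdist u th
      <= m * s%:R * expR (Num.sqrt (2 * ln (n%:R / s%:R))))%R])
    <= (expR (- (m * s%:R)) + expR (- (s%:R / 4)))%:E)%E.
Proof.
have [C C0 HC] := null_score_le R.
have [c1 c101 Hpost] := post_ball_le.
have /andP[c10 c11] := c101.
(* [c <= 4^-1] keeps the weight a at most 1/4; [C * c <= 4^-1] keeps the null cost below s/4, half
   of the signal gain s/2. *)
have [c c0 [c4 Cc]] : exists2 c : R, 0 < c & c <= 4^-1 /\ C * c <= 4^-1.
  exists (4 * (C + 1))^-1; first by rewrite invr_gt0; lra.
  split; first by rewrite lef_pV2 ?posrE; lra.
  by rewrite ler_pdivrMr; lra.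
have p1 : 0 < phi 1 :> R := phi_gt0 _ _.
(* With n - s >= n/2, the factor 1/4 makes M at most half of the exponent (n - s) c1 a phi(1) gained
   from the null coordinates. *)
have [m m0 mE] : exists2 m : R, 0 < m & m = c * c1 * phi 1 / 4.
  by eexists; last reflexivity; rewrite divr_gt0// mulr_gt0// mulr_gt0.
exists m => // n s an ahat an0 hmax s0 sn; set L := Num.sqrt _ => L6.
have s0R : 0 < s%:R :> R by rewrite ltr0n.
have sn2R : s%:R * 2 <= n%:R :> R by rewrite -natrM ler_nat.
have n0R : 0 < n%:R :> R by lra.
have sn' : (s <= n)%N by apply: leq_trans sn; rewrite leq_pmulr.
have [r rE] : exists r : R, r = expR (- (L ^+ 2 / 2)) by exists (expR (- (L ^+ 2 / 2))).
have rsn : r = s%:R / n%:R.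
  have L2 : L ^+ 2 = 2 * ln (n%:R / s%:R).
    rewrite sqr_sqrtr// mulr_ge0// ln_ge0// ler_pdivlMr//; lra.
  rewrite rE L2 mulrAC divff// mul1r expRN lnK ?posrE ?divr_gt0//.
  by rewrite invf_div.
have r0 : 0 < r by rewrite rE expR_gt0.
have eL1 : 1 <= expR L by rewrite -expR0 ler_expR; lra.
have eLr : expR L * r <= 1 by rewrite rE -expRD expR_le1; nra.
have [a aE] : exists a, a = c * expR L * r by eexists.
have a0 : 0 < a by rewrite aE mulr_gt0// mulr_gt0 ?expR_gt0.
have a4 : a <= 4^-1 by rewrite aE -mulrA; nra.
have a1 : a <= 1 by lra.
have a01 : 0 < a <= 1 by rewrite a0.
have k01 : 0 <= c1 * a <= 1 by rewrite mulr_ge0 ?ltW//=; nra.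
have [A HA] : exists A : R,
    (\int[mu]_x (expR (spike_ratio _ a x - 1) * phi (x - A))%:E <= (expR (- 2^-1))%:E)%E.
  by apply: signal_score_le; rewrite a0; lra.
pose th : n.-tuple R := mktuple (fun i : 'I_n => if (i < s)%N then A else 0).
have thE i : (i < n)%N -> nth 0 th i = if (i < s)%N then A else 0.
  by move=> ni; rewrite (_ : i = Ordinal ni)// -tnth_nth tnth_mktuple.
have th0 i : (s <= i)%N -> nth 0 th i = 0.
  move=> si; have [ni|ni] := ltnP i n; last by rewrite nth_default// size_tuple.
  by rewrite thE// ltnNge si.
exists th; split.
  rewrite /ell0 -[leqRHS]card_ord.
  apply: leq_trans (leq_image_card (widen_ord sn') 'I_s).
  apply/subset_leq_card/fintype.subsetP => i.
  rewrite inE /= /th tnth_mktuple; case: ltnP => [si _|]; last by rewrite eqxx.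
  by apply/fintype.imageP; exists (Ordinal si) => //; apply: val_inj.
set M := m * s%:R * expR L.
(* The first product bounds the posterior probability when [ahat x >= a]; otherwise the second
   product is at least 1. Their sum covers both cases. *)
have Fle x : (0 <= post_prob (ahat x) x [set u | (sqdist u th <= M)%R] <=
    (expR M * \prod_(i < n) thin s (c1 * a) i (tnth x i) +
     1 * \prod_(i < n) expR (spike_ratio _ a (tnth x i) - 1))%:E)%E.
  have [/andP[h1 h2] hb] := hmax x.
  have [ax|ax] := leP a (ahat x).
    have /andP[-> H] := Hpost n s x th (ahat x) a M (introT andP (conj a0 ax)) h2 th0.
    apply: (le_trans H); rewrite lee_fin lerDl mul1r prodr_ge0// => i _; exact: expR_ge0.
  have h0 : 0 < ahat x by exact: lt_le_trans h1.
  have /andP[-> H] := post_prob_le1 n x (ahat x) [set u | sqdist u th <= M]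
    (introT andP (conj h0 h2)).
  apply: (le_trans H); rewrite lee_fin mul1r.
  apply: (@le_trans _ _ (\prod_(i < n) expR (spike_ratio _ a (tnth x i) - 1))); last first.
    rewrite lerDr mulr_ge0 ?expR_ge0// prodr_ge0// => i _; exact: thin_ge0.
  rewrite -expR_sum -[leLHS]expR0 ler_expR -oppr_le0 -sumrN.
  under eq_bigr do rewrite opprB.
  apply: (score_le0 n x (ahat x)) => //; first by rewrite h0.
  by apply: hb; rewrite a1 (le_trans h1)// ltW.
(* [p i] and [q i] bound the means under [th] of the i-th factors of the two products. *)
pose p i : R := if (i < s)%N then 1 else 1 - c1 * a * phi 1.
pose q i : R := if (i < s)%N then expR (- 2^-1) else 1 + C * (c * r).
have := iter_int_le R n (fun i h => \int[normal_prob (nth 0%R th i) 1]_y h y)%E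
  (thin s (c1 * a)) (fun _ x => expR (spike_ratio _ a x - 1)) p q (expR M) 1 _ _ _ _ _ _ Fle.
case/(_ _ _ _ _ _)/andP => //.
- by move=> i x; exact: thin_ge0.
- move=> i ni b b' h b0 b0' hb.
  apply: (normal_int_le R (nth 0 th i) (p i) (q i) (thin s (c1 * a) i)
    (fun x => expR (spike_ratio _ a x - 1))) => //.
  + exact: measurable_thin.
  + exact: measurable_exp_score.
  + by move=> x; exact: thin_ge0.
  + rewrite thE// /p /thin; case: ifP => _; last exact: integral_thinned_phi.
    by under eq_integral do rewrite mul1r; rewrite integral_phi.
  + rewrite thE// /q; case: ifP => _ //.
    under eq_integral do rewrite subr0.
    by apply: (HC c L) => //; rewrite c0; lra.
move=> -> /le_trans -> //=; rewrite lee_fin mul1r.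
have ns : (n - s)%:R = n%:R - s%:R :> R by rewrite natrB.
(* That phi(1) <= 1 is read off from [integral_thinned_phi] at k = 1, whose left side is
   nonnegative. *)
have q1 : 0 <= (phi 1 : R) <= 1.
  rewrite ltW//= -subr_ge0 -[phi 1]mul1r -lee_fin.
  apply: le_trans (integral_thinned_phi R 1 _); last by rewrite ler01 lexx.
  apply: integral_ge0 => x _; rewrite lee_fin mulr_ge0 ?(ltW (phi_gt0 _ _))//.
apply: lerD.
  apply: (@le_trans _ _ (expR M * expR (s%:R * 0 + (n - s)%:R * - (c1 * a * phi 1)))).
    rewrite ler_pM2l ?expR_gt0//; apply: prod_le_expR_if => // i.
    rewrite /p; case: ifP => _; first by rewrite expR0 ler01 lexx.
    rewrite subr_ge0 expR_ge1Dx andbT.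
    by case/andP: q1 => *; case/andP: k01 => *; nra.
  rewrite -expRD ler_expR mulr0 add0r mulrN lerNr opprB -subr_ge0.
  have Ms : m * s%:R <= M by rewrite /M ler_peMr// mulr_ge0// ltW.
  (* Hence the total exponent is at most M - 2M = -M <= -m s. *)
  have : 2 * M <= (n - s)%:R * (c1 * a * phi 1).
    rewrite /M mE aE rsn ns.
    rewrite [leLHS](_ : _ = c * c1 * phi 1 * expR L * s%:R * 2^-1); last by field.
    rewrite [leRHS](_ : _ = c * c1 * phi 1 * expR L * s%:R * ((n%:R - s%:R) / n%:R)); last first.
      by field; exact: lt0r_neq0.
    rewrite ler_pM2l; last by do 4! [rewrite mulr_gt0 ?expR_gt0//].
    by rewrite ler_pdivlMr//; lra.
  lra.
apply: (@le_trans _ _ (expR (s%:R * - 2^-1 + (n - s)%:R * (C * (c * r))))).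
  apply: prod_le_expR_if => // i.
  rewrite /q; case: ifP => _; first by rewrite expR_ge0 lexx.
  by rewrite expR_ge1Dx andbT addr_ge0// mulr_ge0 ?ltW// mulr_gt0.
rewrite ler_expR.
have : (n - s)%:R * (C * (c * r)) <= s%:R / 4.
  apply: (@le_trans _ _ (n%:R * (C * (c * r)))).
    by rewrite ler_wpM2r ?ns ?gerBl ?(ltW s0R)// mulr_ge0 ?(ltW C0)// mulr_ge0// ltW.
  have -> : n%:R * (C * (c * r)) = (C * c) * s%:R by rewrite rsn; field; exact: lt0r_neq0.
  by rewrite mulrC ler_pM2l.
lra.
Qed.

End assembly.

(** * Passage to the limit *)

Lemma cvg_ln_nat (R : realType) : ln (n%:R : R) @[n --> \oo] --> +oo%R.
Proof.
apply/cvgryPge => A; near=> n.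
have H : expR A <= n%:R by near: n; exact: nbhs_infty_ger.
by rewrite -[A]expRK ler_ln ?posrE ?expR_gt0// (lt_le_trans _ H) ?expR_gt0.
Unshelve. all: by end_near. Qed.

(** If s_n stayed below A, then ln^2 n would be at most |C|(1 + |A|), which fails once ln n exceeds
    1 plus that number. Divergence of s_n makes both exponential error terms vanish. *)
Lemma cvg_natr_of_sqr_ln (R : realType) (s : nat -> nat) :
  (exists C : R, \forall n \near \oo, ln (n%:R : R) ^+ 2 <= C * (s n)%:R) ->
  ((s n)%:R : R) @[n --> \oo] --> +oo%R.
Proof.
move=> [C HC]; apply/cvgryPge => A; near=> n.
have H1 : ln (n%:R : R) ^+ 2 <= C * (s n)%:R by near: n.
have H2 : 1 + `|C| * (1 + `|A|) <= ln (n%:R : R).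
  by near: n; have /cvgryPge := cvg_ln_nat R; apply.
have Cs : C * (s n)%:R <= `|C| * (s n)%:R by rewrite ler_wpM2r// ler_norm.
have C0 : 0 <= `|C| by []; have A0 : 0 <= `|A| by [].
apply: (le_trans (ler_norm A)); rewrite leNgt; apply/negP => sA.
have s0 : 0 <= (s n)%:R :> R by [].
have : `|C| * (s n)%:R <= `|C| * (1 + `|A|) by rewrite ler_wpM2l//; lra.
have : 0 <= `|C| * (1 + `|A|) by rewrite mulr_ge0//; lra.
nra.
Unshelve. all: by end_near. Qed.

Theorem theorem2 (R : realType)
  (alpha_n : nat -> R)
  (h_alpha_n : \forall n \near \oo,
      0 < alpha_n n < 1 /\ thresh (alpha_n n) = Num.sqrt (2 * ln (n%:R)))
  (alpha_hat : forall n : nat, n.-tuple R -> R)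
  (h_meas : forall n : nat, measurable_fun [set: n.-tuple R] (alpha_hat n))
  (h_max : forall (n : nat) (x : n.-tuple R),
      alpha_n n <= alpha_hat n x <= 1 /\
      (forall b : R, alpha_n n <= b <= 1 -> loglik x b <= loglik x (alpha_hat n x))) :
  exists m : R, 0 < m /\
    forall s : nat -> nat,
      ((fun n => (s n)%:R / n%:R : R) @ \oo --> 0) ->
      (exists C : R, \forall n \near \oo, ln (n%:R : R) ^+ 2 <= C * (s n)%:R) ->
      exists theta0 : forall n : nat, n.-tuple R,
        (forall n, ell0 (s n) (theta0 n)) /\
        ((fun n => expect (theta0 n) (fun x =>
            post_prob (alpha_hat n x) x
              [set th | sqdist th (theta0 n)
                        <= m * (s n)%:R * expR (Num.sqrt (2 * ln (n%:R / (s n)%:R)))]))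
          @ \oo --> 0%E).
Proof.
have [m m0 Hm] := expect_ball_le R; exists m; split => // s s_n0 s_ln.
pose good n := [/\ 0 < alpha_n n, (0 < s n)%N, (s n * 2 <= n)%N &
  6 <= Num.sqrt (2 * ln (n%:R / (s n)%:R : R))].
have HE n : exists th : n.-tuple R, ell0 (s n) th /\ (good n ->
   (0 <= expect th (fun x => post_prob (alpha_hat n x) x [set u | (sqdist u th
      <= m * (s n)%:R * expR (Num.sqrt (2 * ln (n%:R / (s n)%:R))))%R])
    <= (expR (- (m * (s n)%:R)) + expR (- ((s n)%:R / 4)))%:E)%E).
  have [[an0 sn0 sn2 L6]|ngood] := pselect (good n).
    have [th [h1 h2]] := Hm n (s n) (alpha_n n) (alpha_hat n) an0 (h_max n) sn0 sn2 L6.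
    by exists th; split.
  (* The zero vector is a default outside [good], admissible for every sparsity level; [good] holds
     for all large n. *)
  exists (nseq_tuple n 0); split => //.
  rewrite /ell0 (_ : #|_| = 0%N)//; apply: eq_card0 => i.
  apply/negP; rewrite -topredE /= !inE /= (tnth_nth 0) nth_nseq; case: ifP => _; exact/negP/negPn/eqxx.
pose th n := sval (cid (HE n)).
have thP n := svalP (cid (HE n)); rewrite -/(th _) in thP.
exists th; split; first by move=> n; have [] := thP n.
have s_oo := cvg_natr_of_sqr_ln R s s_ln.
have goodN : \forall n \near \oo, good n.
  near=> n.
  have an0 : 0 < alpha_n n < 1 /\ thresh (alpha_n n) = Num.sqrt (2 * ln (n%:R)) by near: n.
  have s1 : 1 <= (s n)%:R :> R by near: n; have /cvgryPge := s_oo; apply.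
  have n1 : (0 < n)%N by near: n; exact: nbhs_infty_gt.
  (* The value 18 is 6^2/2: n/s >= e^18 gives L >= 6, and e^{-18} <= 1/2 gives 2s <= n. *)
  have sn : `|0 - (s n)%:R / n%:R| <= expR (- 18) :> R.
    near: n; have /cvgrPdist_le := s_n0; apply; exact: expR_gt0.
  have s0 : (0 < s n)%N by rewrite -(ltr0n R); lra.
  have s0R : 0 < (s n)%:R :> R by rewrite ltr0n.
  have n0R : 0 < n%:R :> R by rewrite ltr0n.
  have {}sn : (s n)%:R / n%:R <= expR (- 18) :> R.
    by move: sn; rewrite sub0r normrN ger0_norm// divr_ge0// ltW.
  split => //.
  - by have [/andP[]] := an0.
  - rewrite -(ler_nat R) natrM -ler_pdivlMr// mulrC -ler_pdivrMr// (le_trans sn)//.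
    have := expR_ge1Dx (18 : R); rewrite expRN => H.
    rewrite lef_pV2 ?posrE ?expR_gt0//; lra.
  have H : 18 <= ln (n%:R / (s n)%:R : R).
    rewrite -[18]expRK ler_ln ?posrE ?expR_gt0 ?divr_gt0//.
    rewrite -[leRHS]invrK -[leLHS]invrK lef_pV2 ?posrE ?invr_gt0 ?expR_gt0 ?divr_gt0//.
    by rewrite invf_div -expRN.
  rewrite -(@ler_pXn2r _ 2) ?nnegrE ?sqrtr_ge0// sqr_sqrtr; last by rewrite mulr_ge0//; lra.
  lra.
have cvg0 (c : R) : 0 < c -> expR (- (c * (s n)%:R)) @[n --> \oo] --> (0 : R).
  move=> c0; apply: (@cvg_comp _ _ _ (fun n => c * (s n)%:R) (fun y => expR (- y)) _ +oo%R).
    apply/cvgryPge => A; have /cvgryPge/(_ (A / c)) := s_oo.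
    by apply: filterS => n; rewrite ler_pdivrMr// mulrC.
  exact: cvgr_expR.
apply: (@squeeze_cvge _ _ _ _ (cst 0%E) _ (fun n => (expR (- (m * (s n)%:R)) + expR (- ((s n)%:R / 4)))%:E)).
- near=> n; have [_] := thP n; apply; near: n; exact: goodN.
- exact: cvg_cst.
apply: cvg_EFin; first exact: nearW.
rewrite -[0 in X in _ --> X]addr0; apply: cvgD; first exact: cvg0.
under eq_fun do rewrite mulrC.
by apply: cvg0; rewrite invr_gt0.
Unshelve. all: by end_near. Qed.
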